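(* Let $\sigma>0$, $\rho_1\ge1$, let $\beta_n=\rho_1^n$ for $n\ge0$, and let $\vec\alpha=(\alpha_n)_{n\ge0}$ be a non-negative sequence, not identically zero, with $$\sum_{m=0}^\infty m\,\alpha_m\rho_1^m<\infty.$$ For each $L\ge1$ let $(\gamma^{(L)}_0,\dots,\gamma^{(L)}_L)$ be a random Motzkin path sampled from $\Pr_L$ (defined in the context), and set $\gamma^{(L)}_k:=0$ for $k>L$. Then the family $\{\gamma^{(L)}_L\}_{L\ge1}$ is not tight, and as $L\to\infty$, $$\Big(\{\gamma^{(L)}_k\}_{k\ge0},\ \{\gamma^{(L)}_{L-k}-\gamma^{(L)}_{L-k+1}\}_{k\ge1}\Big)\Rightarrow\Big(\{Z_k\}_{k\ge0},\{\xi_k\}_{k\ge1}\Big)$$ in the sense of convergence of finite-dimensional distributions (for $k>L$ the increments are set to $0$), where: - $\{Z_k\}_{k\ge0}$ is a Markov chain on $\mathbb Z_{\ge0}$ with transition probabilities $\mathsf Q^{(\rho_1)}_{n,m}$ (defined in the context) and initial law $$\Pr(Z_0=n)=\frac{1}{\mathfrak C_{\vec\alpha,\rho_1}}\,\alpha_n\,\frac{\rho_1^{n+1}-\rho_1^{-(n+1)}}{\rho_1-\rho_1^{-1}},\quad n\ge0,\qquad \mathfrak C_{\vec\alpha,\rho_1}=\sum_{n\ge0}\alpha_n\frac{\rho_1^{n+1}-\rho_1^{-(n+1)}}{\rho_1-\rho_1^{-1}},$$ where for $\rho_1=1$ the ratio $\frac{\rho_1^{n+1}-\rho_1^{-(n+1)}}{\rho_1-\rho_1^{-1}}$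 is interpreted as $n+1$; - $\{\xi_k\}_{k\ge1}$ are i.i.d. with $\Pr(\xi_1=1)=\frac{1/\rho_1}{\rho_1+1/\rho_1+\sigma}$, $\Pr(\xi_1=0)=\frac{\sigma}{\rho_1+1/\rho_1+\sigma}$, $\Pr(\xi_1=-1)=\frac{\rho_1}{\rho_1+1/\rho_1+\sigma}$; - the two families are independent.
   Context: A Motzkin path of length $L\in\mathbb Z_{\ge1}$ is a sequence $\vec\gamma=(\gamma_0,\dots,\gamma_L)$ of non-negative integers with $|\gamma_k-\gamma_{k-1}|\le1$; $\mathcal M^{(L)}$ is the set of all such paths. Its weight is $w(\vec\gamma)=\sigma^{\#\{k:\ \gamma_k=\gamma_{k-1}\}}$. With boundary weights $\vec\alpha,\vec\beta$, $\mathfrak C_{\vec\alpha,\vec\beta,L}=\sum_{\vec\gamma\in\mathcal M^{(L)}}\alpha_{\gamma_0}\beta_{\gamma_L}w(\vec\gamma)$ (finite under the hypotheses) and $\Pr_L(\vec\gamma)=\alpha_{\gamma_0}\beta_{\gamma_L}w(\vec\gamma)/\mathfrak C_{\vec\alpha,\vec\beta,L}$. Transition kernels: for $\rho>0$, $\rho\neq1$, $$\mathsf Q^{(\rho)}_{n,m}=\frac{1}{\rho+1/\rho+\sigma}\begin{cases}\frac{\rho^{n+2}-\rho^{-(n+2)}}{\rho^{n+1}-\rho^{-(n+1)}}, & m=n+1,\\ \sigma, & m=n,\\ \frac{\rho^{n}-\rho^{-n}}{\rho^{n+1}-\rho^{-(n+1)}}, & m=n-1,\\ 0,&\text{otherwise},\end{cases}$$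 and $\mathsf Q^{(1)}_{n,m}$ (the limit as $\rho\to1$) equals $\frac{1}{2+\sigma}\frac{n+2}{n+1}$ if $m=n+1$, $\frac{\sigma}{2+\sigma}$ if $m=n$, $\frac{1}{2+\sigma}\frac{n}{n+1}$ if $m=n-1\ge0$, and $0$ otherwise. *)

(* Defs.v *)
From HB Require Import structures.
From mathcomp Require Import all_boot all_order all_algebra.
From mathcomp Require Import all_classical all_reals all_analysis.
Set Implicit Arguments. Unset Strict Implicit. Unset Printing Implicit Defensive.
Import Order.TTheory GRing.Theory Num.Theory.
Import numFieldNormedType.Exports.
Local Open Scope classical_set_scope.
Local Open Scope ring_scope.

Section MotzkinDefs.
Variable R : realType.

Definition motzkin (L : nat) : set (seq nat) :=
  [set g | size g = L.+1 /\
     forall k : nat, (0 < k <= L)%N ->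
       (nth 0%N g k <= (nth 0%N g k.-1).+1)%N /\
       (nth 0%N g k.-1 <= (nth 0%N g k).+1)%N].

Definition flats (L : nat) (g : seq nat) : nat :=
  (\sum_(1 <= k < L.+1) (nth 0%N g k == nth 0%N g k.-1 : nat))%N.

Definition path_mass (alpha beta : nat -> R) (sigma : R) (L : nat)
    (g : seq nat) : R :=
  alpha (nth 0%N g 0) * beta (nth 0%N g L) * sigma ^+ flats L g.

Definition path_weight (alpha beta : nat -> R) (sigma : R) (L : nat)
    (E : set (seq nat)) : \bar R :=
  \esum_(g in motzkin L `&` E) (path_mass alpha beta sigma L g)%:E.

Definition partition_fn (alpha beta : nat -> R) (sigma : R) (L : nat) : \bar R :=
  path_weight alpha beta sigma L setT.

Definition PrL (alpha beta : nat -> R) (sigma : R) (L : nat)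
    (E : set (seq nat)) : R :=
  fine (path_weight alpha beta sigma L E) / fine (partition_fn alpha beta sigma L).

(* gamma_k (= 0 for k > L, automatically through the default of nth) *)
Definition gam (g : seq nat) (k : nat) : nat := nth 0%N g k.

Definition incr (L : nat) (g : seq nat) (k : nat) : int :=
  if (k <= L)%N then ((gam g (L - k))%:Z - (gam g (L - k).+1)%:Z)%R else 0%R.

Definition Qker (rho sigma : R) (n m : nat) : R :=
  if rho == 1 then
    (if m == n.+1 then (2 + sigma)^-1 * ((n.+2)%:R / (n.+1)%:R)
     else if m == n then sigma / (2 + sigma)
     else if m.+1 == n then (2 + sigma)^-1 * (n%:R / (n.+1)%:R)
     else 0)
  else
    (rho + rho^-1 + sigma)^-1 *
    (if m == n.+1 then (rho ^+ n.+2 - rho ^- n.+2) / (rho ^+ n.+1 - rho ^- n.+1)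
     else if m == n then sigma
     else if m.+1 == n then (rho ^+ n - rho ^- n) / (rho ^+ n.+1 - rho ^- n.+1)
     else 0).

Definition hfun (rho : R) (n : nat) : R :=
  if rho == 1 then n.+1%:R
  else (rho ^+ n.+1 - rho ^- n.+1) / (rho - rho^-1).

Definition Calpha (alpha : nat -> R) (rho : R) : R :=
  fine (\sum_(0 <= n <oo) (alpha n * hfun rho n)%:E)%E.

Definition init_law (alpha : nat -> R) (rho : R) (n : nat) : R :=
  alpha n * hfun rho n / Calpha alpha rho.

Definition xi_law (rho sigma : R) (x : int) : R :=
  if x == 1%R then rho^-1 / (rho + rho^-1 + sigma)
  else if x == 0%R then sigma / (rho + rho^-1 + sigma)
  else if x == (-1)%R then rho / (rho + rho^-1 + sigma)
  else 0.

(* P(Z_k = z k for 0 <= k <= K, xi_k = x k for 1 <= k <= K), for the Markov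
   chain Z with initial law init_law and kernel Qker, independent of the iid xi *)
Definition limit_fdd (alpha : nat -> R) (rho sigma : R) (K : nat)
    (z : nat -> nat) (x : nat -> int) : R :=
  init_law alpha rho (z 0%N)
  * (\prod_(0 <= k < K) Qker rho sigma (z k) (z k.+1))
  * (\prod_(1 <= k < K.+1) xi_law rho sigma (x k)).

Definition cyl (L K : nat) (z : nat -> nat) (x : nat -> int) : set (seq nat) :=
  [set g | (forall k, (k <= K)%N -> gam g k = z k) /\
           (forall k, (1 <= k <= K)%N -> incr L g k = x k)].

End MotzkinDefs.

(* Main.v *)
Require Import Defs.
From HB Require Import structures.
From mathcomp Require Import all_boot all_order all_algebra.
From mathcomp Require Import all_classical all_reals all_analysis.
From mathcomp Require Import ring lra zify.
Import Order.TTheory GRing.Theory Num.Theory.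
Import numFieldNormedType.Exports.
Local Open Scope classical_set_scope.
Local Open Scope ring_scope.

Set Implicit Arguments.
Unset Strict Implicit.

(* Let T be the transfer operator of the weighted walk killed below 0, and W_L n
   the total weight of the paths of length L from n, with end weight rho^(end).
   The function h = hfun rho satisfies T h = S h with S = rho + 1/rho + sigma,
   and T rho^. = S rho^. - rho^-1 delta_0, so that the weight of the paths from n
   ending at 0 is rho (S W_L n - W_(L+1) n).  Everything rests on the ratio limit
   W_(L+1) 0 / W_L 0 --> S: the recursion then gives W_L n / W_L 0 --> h n, the
   weight of the paths with a bounded end is o(W_L 0) (hence no tightness), and
   deep in the bulk the last K increments simply tilt by rho, which produces the
   law of xi independently of the first K steps.  Sums over the starting point are
   controlled by the domination W_L n <= h n * W_L 0.

   For rho > 1 the ratio limit holds because W_L 0 / S^L decreases to a positive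
   limit.  For rho = 1 this limit is 0; there the reflection principle writes W_L 0
   through free walks, and differentiating (x + sigma + 1/x)^(L+1) bounds the
   weight of the excursions of length L by S W_L 0 / (L + 1). *)

(* Tannery's theorem in the case where the limits are the dominating terms:
   only a lower bound on finite truncations is needed. *)
Lemma cvg_dominated_nneseries (R : realType) (a : nat -> R) (u : nat -> nat -> R)
    (A : R) :
  (\sum_(0 <= n <oo) (a n)%:E = A%:E)%E ->
  (forall L n, 0 <= u L n <= a n) ->
  (forall n, u L n @[L --> \oo] --> a n) ->
  fine (\sum_(0 <= n <oo) (u L n)%:E)%E @[L --> \oo] --> A.
Proof.
move=> aA ua ucvg.
have u0 L n : (0 <= (u L n)%:E)%E by rewrite lee_fin; case/andP: (ua L n).
have a0 n : (0 <= (a n)%:E)%E.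
  by rewrite lee_fin; case/andP: (ua 0%N n) => /le_trans; exact.
have uA L : (\sum_(0 <= n <oo) (u L n)%:E <= A%:E)%E.
  by rewrite -aA; apply: lee_nneseries => // n _; rewrite lee_fin; case/andP: (ua L n).
have ufin L : (\sum_(0 <= n <oo) (u L n)%:E)%E \is a fin_num.
  rewrite ge0_fin_numE; last exact: nneseries_ge0.
  by rewrite (le_lt_trans (uA L))// ltry.
have partial : \sum_(0 <= n < M) a n @[M --> \oo] --> A.
  have : (\sum_(0 <= n < M) (a n)%:E)%E @[M --> \oo] --> A%:E.
    by rewrite -aA; apply: is_cvg_nneseries => n _ _; exact: a0.
  move=> /fine_cvg; apply: cvg_trans; apply: near_eq_cvg.
  by apply: nearW => M /=; rewrite sumEFin.
apply/cvgrPdist_le => e e0.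
have /cvgrPdist_lt/(_ (e / 2)) := partial.
rewrite divr_gt0// => /(_ isT) [M _ /(_ M (leqnn M)) /= aM].
have uM : \sum_(0 <= n < M) u L n @[L --> \oo] --> \sum_(0 <= n < M) a n.
  by apply: cvg_big => [|n _]; [exact: add_continuous|exact: ucvg].
have /cvgrPdist_lt/(_ (e / 2)) := uM.
rewrite divr_gt0// => /(_ isT) nearuM.
near=> L.
have uL : `|\sum_(0 <= n < M) a n - \sum_(0 <= n < M) u L n| < e / 2 by near: L.
have lo : \sum_(0 <= n < M) u L n <= fine (\sum_(0 <= n <oo) (u L n)%:E)%E.
  rewrite -lee_fin fineK// -sumEFin.
  exact: (@nneseries_lim_ge _ (fun n => (u L n)%:E) xpredT).
have hi : fine (\sum_(0 <= n <oo) (u L n)%:E)%E <= A by rewrite -lee_fin fineK.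
rewrite ger0_norm ?subr_ge0//.
move: aM uL => /ltr_normlW aM /ltr_normlW uL; lra.
Unshelve. all: by end_near.
Qed.

Lemma nneseries_delta (R : realType) (a : nat -> R) k :
  0 <= a k -> (forall n, n != k -> a n = 0) ->
  (\sum_(0 <= n <oo) (a n)%:E = (a k)%:E)%E.
Proof.
move=> ak a0; rewrite (@nneseriesD1 _ _ k)//= => [|n _]; last first.
  by case: (eqVneq n k) => [->|/a0 ->]; rewrite lee_fin.
by rewrite eseries0 ?adde0// => n _ /a0 ->.
Qed.

Lemma fine_nneseriesZl (R : realType) (c : R) (a : nat -> R) :
  0 < c -> (forall n, 0 <= a n) ->
  fine (\sum_(0 <= n <oo) (c * a n)%:E)%E = c * fine (\sum_(0 <= n <oo) (a n)%:E)%E.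
Proof.
move=> c0 a0; under eq_eseriesr do rewrite EFinM.
rewrite nneseriesZl => [|n _]; last by rewrite lee_fin.
case: (\sum_(0 <= n <oo) (a n)%:E)%E => [r| |] //=.
  by rewrite gt0_muley ?lte_fin//= mulr0.
by rewrite gt0_muleNy ?lte_fin//= mulr0.
Qed.

Section Transfer.
Variables (R : realType) (sigma rho : R).
Hypotheses (sigma_gt0 : 0 < sigma) (rho_ge1 : 1 <= rho).

(** * The transfer operator and its harmonic function *)

Definition transfer (f : nat -> R) (n : nat) : R :=
  f n.+1 + sigma * f n + (if n is m.+1 then f m else 0).

Definition titer L f := iter L transfer f.

Lemma titerS L f : titer L.+1 f = transfer (titer L f).
Proof. by []. Qed.

Lemma titerSr L f : titer L.+1 f = titer L (transfer f).
Proof. exact: iterSr. Qed.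

Lemma titerD L M f : titer (L + M) f = titer L (titer M f).
Proof. exact: iterD. Qed.

Lemma transfer_le f g :
  (forall n, f n <= g n) -> forall n, transfer f n <= transfer g n.
Proof.
move=> fg n; rewrite /transfer !lerD ?ler_wpM2l ?(ltW sigma_gt0)//.
by case: n.
Qed.

Lemma titer_le L f g :
  (forall n, f n <= g n) -> forall n, titer L f n <= titer L g n.
Proof. by move=> fg; elim: L => //= L IH; exact: transfer_le. Qed.

Lemma titer_ge0 L f : (forall n, 0 <= f n) -> forall n, 0 <= titer L f n.
Proof.
move=> f0; elim: L => //= L IH n.
rewrite /transfer !addr_ge0 ?mulr_ge0 ?(ltW sigma_gt0)//.
by case: n.
Qed.

Lemma titer_lin L a b f g n :
  titer L (fun n => a * f n + b * g n) n = a * titer L f n + b * titer L g n.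
Proof.
elim: L n => //= L IH n; rewrite /transfer !IH.
by case: n => [|n]; rewrite ?IH; ring.
Qed.

Lemma titerZ L a f n : titer L (fun n => a * f n) n = a * titer L f n.
Proof.
have := titer_lin L a 0 f f n; rewrite mul0r addr0 => <-.
by congr titer; apply/funext => k; rewrite mul0r addr0.
Qed.

Lemma titer_sum L (f : nat -> nat -> R) M n :
  titer L (fun k => \sum_(i < M) f i k) n = \sum_(i < M) titer L (f i) n.
Proof.
elim: M => [|M IH].
  rewrite big_ord0 -[RHS](mul0r (titer L (f 0%N) n)) -titerZ; congr titer.
  by apply/funext => k; rewrite big_ord0 mul0r.
rewrite big_ord_recr /= -IH.
have := titer_lin L 1 1 (fun k => \sum_(i < M) f i k) (f M) n.
rewrite !mul1r => <-; congr titer; apply/funext => k.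
by rewrite big_ord_recr !mul1r.
Qed.

Definition point (m n : nat) : R := (n == m)%:R.

Lemma point_ge0 m n : 0 <= point m n.
Proof. exact: ler0n. Qed.

Lemma point_le_titer m n : point m n <= titer m (point 0) n.
Proof.
elim: m n => [//|m IH] n; rewrite titerS; apply: (le_trans _ (transfer_le IH n)).
rewrite /transfer /point.
case: n => [|n] /=; first by rewrite addr_ge0// addr_ge0 ?mulr_ge0 ?(ltW sigma_gt0).
rewrite eqSS lerDr addr_ge0 ?mulr_ge0 ?(ltW sigma_gt0)//.
Qed.

Local Notation S := (rho + rho^-1 + sigma).
Notation h := (hfun rho).
Local Notation b := (GRing.exp rho).

Lemma rho_gt0 : 0 < rho.
Proof. exact: lt_le_trans rho_ge1. Qed.
Let r0 := rho_gt0.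
Let rn0 : rho != 0. Proof. by rewrite gt_eqF. Qed.
Let ri0 : 0 < rho^-1. Proof. by rewrite invr_gt0. Qed.

Lemma S_gt0 : 0 < S.
Proof. by rewrite !addr_gt0. Qed.

Lemma hfun0 : h 0 = 1.
Proof.
rewrite /hfun; case: eqP => // /eqP r1.
rewrite expr1 divff// subr_eq0; apply/eqP => E.
have : (rho - 1) * (rho + 1) = 0 by rewrite -subr_sqr expr1n expr2 {2}E mulfV// subrr.
move/eqP; rewrite mulf_eq0 subr_eq0 (negbTE r1) /=.
by rewrite gt_eqF// addr_gt0.
Qed.

Lemma hfunS n : h n.+1 = rho * h n + rho ^- n.+1.
Proof.
rewrite /hfun; case: eqP => [->|/eqP r1].
  by rewrite expr1n invr1 mul1r natr1.
have d0 : rho - rho^-1 != 0.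
  apply/eqP => E; have := hfun0; rewrite /hfun (negbTE r1) expr1 E invr0.
  by rewrite mulr0 => /eqP; rewrite eq_sym oner_eq0.
rewrite -[X in _ = _ + X](mulfK d0) mulrA -mulrDl; congr (_ / _).
have -> : rho ^- n.+2 = rho ^- n.+1 * rho^-1 by rewrite -exprVn exprSr exprVn.
rewrite (exprS rho n.+1).
by move: (rho ^- n.+1) (rho ^+ n.+1) => x y; ring.
Qed.

Lemma hfun_step n : h n.+2 = (rho + rho^-1) * h n.+1 - h n.
Proof.
rewrite (hfunS n.+1).
have -> : rho ^- n.+2 = rho^-1 * (h n.+1 - rho * h n).
  by rewrite hfunS addrAC subrr add0r -!exprVn exprS.
by field.
Qed.

Lemma hfun_gt0 n : 0 < h n.
Proof.
elim: n => [|n IH]; first by rewrite hfun0.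
by rewrite hfunS addr_gt0 ?mulr_gt0// invr_gt0 exprn_gt0.
Qed.

Lemma hfun_le n : h n <= n.+1%:R * rho ^+ n.
Proof.
elim: n => [|n IH]; first by rewrite hfun0 expr0 mulr1.
rewrite hfunS -[n.+2%:R]natr1 mulrDl mul1r lerD//.
  by rewrite exprS mulrCA ler_pM2l.
by apply: (@le_trans _ _ 1); rewrite ?invf_le1 ?exprn_ege1 ?exprn_gt0.
Qed.

Lemma transfer_hfun n : transfer h n = S * h n.
Proof.
rewrite /transfer; case: n => [|n]; last by rewrite hfun_step; ring.
by rewrite hfunS hfun0; ring.
Qed.

Lemma titer_hfun L n : titer L h n = S ^+ L * h n.
Proof.
elim: L n => [|L IH] n; first by rewrite mul1r.
rewrite titerS exprS -mulrA mulrCA -transfer_hfun /transfer !IH.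
by case: n => [|n]; rewrite ?IH; ring.
Qed.

Lemma transfer_pow n : transfer b n = S * b n - rho^-1 * point 0 n.
Proof.
rewrite /transfer /point; case: n => [|n] /=; first by rewrite expr0 expr1; ring.
by rewrite !exprS; field.
Qed.

Definition W L := titer L b.

Lemma WS L n : W L.+1 n = transfer (W L) n.
Proof. by []. Qed.

Lemma W_gt0 L n : 0 < W L n.
Proof.
elim: L n => [|L IH] n; first exact: exprn_gt0.
rewrite WS /transfer ltr_pwDl ?addr_gt0 ?mulr_gt0//.
by case: n => // n; apply: ltW.
Qed.

Lemma W_defect L n : rho^-1 * titer L (point 0) n = S * W L n - W L.+1 n.
Proof.
rewrite /W titerSr (_ : transfer b = fun n => S * b n + (- rho^-1) * point 0 n).
  by rewrite titer_lin; ring.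
by apply/funext => k; rewrite transfer_pow mulNr.
Qed.

Lemma WS_le L n : W L.+1 n <= S * W L n.
Proof.
by rewrite -subr_ge0 -W_defect mulr_ge0 ?(ltW ri0)//; apply: titer_ge0; exact: point_ge0.
Qed.

(* A discrete Sturm comparison: [D = h * W L 0 - W L] satisfies
   [D (n+1) - D n / rho >= rho * (D n - D (n-1) / rho)] and [D 0 = 0]. *)
Lemma W_le L n : W L n <= h n * W L 0.
Proof.
pose D n := h n * W L 0 - W L n.
have D0 : D 0%N = 0 by rewrite /D hfun0 mul1r subrr.
have D1 : 0 <= D 1%N.
  rewrite /D hfunS hfun0; have := WS_le L 0; rewrite WS /transfer; lra.
have D2 k : rho * (D k.+1 - rho^-1 * D k) <= D k.+2 - rho^-1 * D k.+1.
  rewrite -subr_ge0 /D hfun_step.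
  have := WS_le L k.+1; rewrite WS /transfer -subr_ge0; congr (_ <= _).
  by field.
have E k : 0 <= D k.+1 - rho^-1 * D k.
  elim: k => [|k IH]; first by rewrite D0 mulr0 subr0.
  by apply: le_trans (D2 k); rewrite mulr_ge0// ltW.
rewrite -subr_ge0 -/(D n); elim: n => [|n IH]; first by rewrite D0.
have := E n; rewrite subr_ge0; apply: le_trans.
by rewrite mulr_ge0// ltW.
Qed.

(** * Ratio limits *)

Lemma hfunSV n : h n.+1 = rho^-1 * h n + rho ^+ n.+1.
Proof.
elim: n => [|n IH]; first by rewrite hfunS hfun0 !expr1 !mulr1 addrC.
have E : h n = rho * (h n.+1 - rho ^+ n.+1) by rewrite IH; field.
by rewrite hfun_step [X in _ - X]E (exprS _ n.+1); ring.
Qed.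

Lemma hfun_le_pow n : (1 - rho ^- 2) * h n <= rho ^+ n.
Proof.
elim: n => [|n IH]; first by rewrite hfun0 mulr1 lerBlDr lerDl invr_ge0 exprn_ge0 ?ltW.
rewrite hfunSV mulrDr mulrCA.
rewrite [leRHS](_ : _ = rho^-1 * rho ^+ n + (1 - rho ^- 2) * rho ^+ n.+1); last first.
  by rewrite exprS; field.
by rewrite lerD2r ler_pM2l.
Qed.

Lemma W_lower L : (1 - rho ^- 2) * S ^+ L <= W L 0.
Proof.
have := titer_le L hfun_le_pow 0.
by rewrite titerZ titer_hfun hfun0 mulr1.
Qed.

Lemma W_ratio_gt1 : 1 < rho -> W L.+1 0 / W L 0 @[L --> \oo] --> S.
Proof.
move=> r1; have S0 := S_gt0.
pose q L := W L 0 / S ^+ L.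
have q0 L : 0 < q L by rewrite divr_gt0 ?W_gt0 ?exprn_gt0.
have c0 : 0 < 1 - rho ^- 2 by rewrite subr_gt0 invf_lt1 ?exprn_gt0// exprn_egt1.
have qc L : 1 - rho ^- 2 <= q L by rewrite ler_pdivlMr ?exprn_gt0// W_lower.
have qcvg : cvgn q.
  apply: nonincreasing_is_cvgn.
    apply/nonincreasing_seqP => L; rewrite /q exprS invfM mulrA.
    rewrite ler_pM2r ?invr_gt0 ?exprn_gt0//.
    by rewrite ler_pdivrMr// mulrC WS_le.
  by exists (1 - rho ^- 2) => _ [L _ <-].
have l0 : limn q != 0.
  by rewrite gt_eqF// (lt_le_trans c0)//; apply: limr_ge => //; apply: nearW.
have -> : (fun L => W L.+1 0 / W L 0) = (fun L => S * (q L.+1 / q L)).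
  apply/funext => L; rewrite /q exprS; move: S0; move: (S) => s s0; field.
  by rewrite !gt_eqF ?W_gt0 ?exprn_gt0.
rewrite -[X in _ --> X]mulr1 -(divff l0).
apply: cvgM; first exact: cvg_cst.
apply: cvgM; last exact: cvgV.
by rewrite (cvg_shiftS q).
Qed.

(* Walks on the integers, unconstrained, from [0] to [n]; by symmetry it suffices
   to keep [n >= 0]. *)
Fixpoint free (L n : nat) : R :=
  match L, n with
  | 0, _ => (n == 0)%:R
  | L.+1, 0 => 2 * free L 1 + sigma * free L 0
  | L.+1, m.+1 => free L m + sigma * free L m.+1 + free L m.+2
  end.

Lemma free_ge0 L n : 0 <= free L n.
Proof.
elim: L n => [|L IH] [|n] //=.
  by rewrite addr_ge0 ?mulr_ge0 ?(ltW sigma_gt0).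
by rewrite !addr_ge0 ?mulr_ge0 ?(ltW sigma_gt0).
Qed.

(* Compares coefficients in [x (f^(L+1))' = (L+1) f^L x f'] for the generating
   function [f = x + sigma + 1/x]. *)
Lemma free_deriv L n :
  n.+1%:R * free L.+1 n.+1 = L.+1%:R * (free L n - free L n.+2).
Proof.
elim: L n => [|L IH] n.
  by case: n => [|n] /=; rewrite ?mul1r ?mulr0 ?addr0 ?subr0 ?mulr1 //; ring.
have -> : free L.+2 n.+1 = free L.+1 n + sigma * free L.+1 n.+1 + free L.+1 n.+2 by [].
case: n => [|n].
  transitivity (sigma * (1%:R * free L.+1 1) + 2%:R * free L.+1 2
                + (free L.+1 0 - free L.+1 2)); first by ring.
  by rewrite !IH /=; ring.
transitivity (n.+1%:R * free L.+1 n.+1 + sigma * (n.+2%:R * free L.+1 n.+2)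
  + n.+3%:R * free L.+1 n.+3 + (free L.+1 n.+1 - free L.+1 n.+3)).
  by ring.
by rewrite !IH /=; ring.
Qed.

(* By reflection the survival count from [n] is the number of free walks ending
   in [{-n, ..., n+1}]. *)
Lemma titer1_free L n :
  titer L (fun=> 1) n = \sum_(i < n.+1) (free L i + free L i.+1).
Proof.
elim: L n => [|L IH] n.
  by rewrite big_ord_recl /= addr0 big1 ?addr0.
have D m : titer L (fun=> 1) m.+1 =
    titer L (fun=> 1) m + (free L m.+1 + free L m.+2) by rewrite !IH big_ord_recr.
rewrite titerS /transfer.
elim: n => [|n IHn]; first by rewrite D IH !big_ord_recr !big_ord0 /=; ring.
rewrite big_ord_recr /= -IHn; case: n {IHn} => [|n]; last by rewrite !D; ring.
by rewrite !D IH big_ord_recr big_ord0 /=; ring.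
Qed.

Lemma W_ratio_eq1 : rho = 1 -> W L.+1 0 / W L 0 @[L --> \oo] --> S.
Proof.
move=> r1.
have Wf L : W L 0 = free L 0 + free L 1.
  transitivity (titer L (fun=> 1) 0); last first.
    by rewrite titer1_free big_ord_recl big_ord0 addr0.
  by congr titer; apply/funext => n; rewrite r1 expr1n.
have lo L : S - S / L.+1%:R <= W L.+1 0 / W L 0.
  have E : S * W L 0 = W L.+1 0 + (free L 0 - free L 2).
    by rewrite !Wf r1 invr1 /=; ring.
  rewrite ler_pdivlMr ?W_gt0// mulrBl E lerBlDr lerD2l.
  rewrite mulrAC ler_pdivlMr// mulrC -free_deriv mul1r.
  by apply: (le_trans _ (WS_le L 0)); rewrite Wf lerDr free_ge0.
apply: (@squeeze_cvgr _ _ _ _ (fun L => S - S / L.+1%:R) (fun=> S)); last exact: cvg_cst.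
  near=> L; rewrite lo /= ler_pdivrMr ?W_gt0//.
  exact: WS_le.
rewrite -[X in _ --> X]subr0; apply: cvgB; first exact: cvg_cst.
rewrite -[X in _ --> X](mulr0 S); apply: cvgM; first exact: cvg_cst.
exact: cvg_harmonic.
Unshelve. all: by end_near.
Qed.

Lemma W_ratio : W L.+1 0 / W L 0 @[L --> \oo] --> S.
Proof.
move: rho_ge1; rewrite le_eqVlt => /predU1P[/esym|]; first exact: W_ratio_eq1.
exact: W_ratio_gt1.
Qed.

Lemma W_ratio_hfun n : W L n / W L 0 @[L --> \oo] --> h n.
Proof.
have step k (l : R) : (W L k / W L 0 @[L --> \oo] --> l) ->
    W L.+1 k / W L 0 @[L --> \oo] --> l * S.
  move=> H; have -> : (fun L => W L.+1 k / W L 0) =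
      (fun L => (W L.+1 k / W L.+1 0) * (W L.+1 0 / W L 0)).
    by apply/funext => L; rewrite mulrA mulfVK// gt_eqF ?W_gt0.
  apply: cvgM; last exact: W_ratio.
  by rewrite (cvg_shiftS (fun L => W L k / W L 0)).
elim/ltn_ind: n => -[_|n IH].
  rewrite hfun0; apply: cvg_near_cst; apply: nearW => L.
  by rewrite divff// gt_eqF ?W_gt0.
have -> : (fun L => W L n.+1 / W L 0) = (fun L => W L.+1 n / W L 0
    - sigma * (W L n / W L 0) - (if n is m.+1 then W L m / W L 0 else 0)).
  apply/funext => L; rewrite WS /transfer; case: n {IH} => [|m].
    by ring.
  by ring.
have -> : h n.+1 = h n * S - sigma * h n - (if n is m.+1 then h m else 0).
  by rewrite [h n * S]mulrC -transfer_hfun /transfer; case: (n) => [|m]; ring.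
apply: cvgB.
  apply: cvgB; first exact: step (IH _ _).
  by apply: cvgM; [exact: cvg_cst | exact: IH].
by case: (n) IH => [|m] IH; [exact: cvg_cst | apply: IH].
Qed.

Lemma W_shift_ratio M n : W (L + M) n / W L 0 @[L --> \oo] --> S ^+ M * h n.
Proof.
elim: M => [|M IH].
  by rewrite mul1r; under eq_fun do rewrite addn0; exact: W_ratio_hfun.
rewrite exprSr mulrAC.
have -> : (fun L => W (L + M.+1) n / W L 0) =
    (fun L => (W (L.+1 + M) n / W L.+1 0) * (W L.+1 0 / W L 0)).
  apply/funext => L; rewrite addnS addSn mulrA mulfVK// gt_eqF ?W_gt0//.
apply: cvgM; last exact: W_ratio.
by rewrite (cvg_shiftS (fun L => W (L + M) n / W L 0)).
Qed.

Lemma titer_point_le L m n :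
  titer L (point m) n <= rho * (S * W (L + m) n - W (L + m).+1 n).
Proof.
rewrite -W_defect mulrA divff// mul1r titerD.
exact: titer_le (point_le_titer m) n.
Qed.

Lemma titer_point_cvg0 m n : titer L (point m) n / W L 0 @[L --> \oo] --> (0 : R).
Proof.
apply: (@squeeze_cvgr _ _ _ _ (fun=> 0) (fun L => rho * (S * (W (L + m) n / W L 0)
  - W (L + m.+1) n / W L 0))).
- near=> L; rewrite divr_ge0 ?(ltW (W_gt0 _ _)) ?(titer_ge0 _ (point_ge0 m))//=.
  rewrite ler_pdivrMr ?W_gt0//; apply: (le_trans (titer_point_le L m n)).
  rewrite le_eqVlt; apply/orP; left; apply/eqP; rewrite addnS; field.
  by rewrite gt_eqF ?W_gt0.
- exact: cvg_cst.
- rewrite [X in _ --> X](_ : 0 = rho * (S * (S ^+ m * h n) - S ^+ m.+1 * h n)).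
    apply: cvgM; first exact: cvg_cst.
    apply: cvgB; last exact: W_shift_ratio.
    by apply: cvgM; [exact: cvg_cst | exact: W_shift_ratio].
  by rewrite exprS; ring.
Unshelve. all: by end_near.
Qed.

(** * Sums over paths *)

Definition motzkin_from (L n : nat) : set (seq nat) :=
  motzkin L `&` [set g | gam g 0 = n].

Fixpoint psum (L n : nat) (F : seq nat -> R) : R :=
  match L with
  | 0 => F [:: n]
  | L.+1 => psum L n.+1 (F \o cons n) + sigma * psum L n (F \o cons n)
      + (if n is m.+1 then psum L m (F \o cons n) else 0)
  end.

Lemma psum_ge0 L n F : (forall g, 0 <= F g) -> 0 <= psum L n F.
Proof.
elim: L n F => [|L IH] n F F0 //=.
have H m : 0 <= psum L m (F \o cons n) by apply: IH => g; exact: F0.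
rewrite !addr_ge0 ?mulr_ge0 ?(ltW sigma_gt0)//.
by case: (n) H.
Qed.

Lemma eq_psum L n F G :
  (forall g, size g = L.+1 -> gam g 0 = n -> F g = G g) -> psum L n F = psum L n G.
Proof.
elim: L n F G => [|L IH] n F G FG /=; first by rewrite FG.
have E m : psum L m (F \o cons n) = psum L m (G \o cons n).
  by apply: IH => g sg _ /=; apply: FG => //=; rewrite sg.
by rewrite !E; case: (n) E => [|m] E; rewrite ?E.
Qed.

Lemma psumZ L n a F : psum L n (fun g => a * F g) = a * psum L n F.
Proof.
elim: L n F => [//|L IH] n F /=.
have E m : psum L m ((fun g => a * F g) \o cons n) = a * psum L m (F \o cons n).
  exact: IH.
by rewrite !E; case: (n) E => [|m] E; rewrite ?E; ring.
Qed.

Lemma flats_cons L n g : flats L.+1 (n :: g) = ((gam g 0 == n) + flats L g)%N.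
Proof.
rewrite /flats big_nat_recl//=; congr (_ + _)%N.
rewrite !big_add1 /=; apply: eq_big_nat => i _.
by case: g.
Qed.

Lemma motzkin_from0 n : motzkin_from 0 n = [set [:: n]].
Proof.
apply/seteqP; split => [g [[sg _] gn]|_ ->].
  by case: g sg gn => [//|a [|//]] _ /= ->.
by split => //; split => // k; rewrite leqn0 lt0n; case: k.
Qed.

Lemma motzkin_fromS L n : motzkin_from L.+1 n =
  cons n @` (\bigcup_(m in [set m | m <= n.+1 /\ n <= m.+1]%N) motzkin_from L m).
Proof.
apply/seteqP; split => [g [[sg mg] gn]|_ [g [m [mn nm] [[sg mg] gm]] <-]].
  case: g sg mg gn => [//|a g] /= [sg] mg an; rewrite -an.
  exists g => //; exists (gam g 0); first by have := mg 1%N isT.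
  by split => //; split => // k kL; have := mg k.+1; case: k kL => //= k kL; exact.
split=> //; split; first by rewrite /= sg.
case=> [//|[_|k kL]] /=; last exact: (mg k.+1 kL).
by rewrite /gam in gm; rewrite gm.
Qed.

Lemma esum_neighbours n (G : nat -> \bar R) : (forall m, (0 <= G m)%E) ->
  (\esum_(m in [set m | m <= n.+1 /\ n <= m.+1]%N) G m =
   G n.+1 + G n + (if n is k.+1 then G k else 0))%E.
Proof.
move=> G0; rewrite (esumID [set n.+1])//.
rewrite (_ : _ `&` [set n.+1] = [set n.+1]); last first.
  by apply/seteqP; split => [k []//|k ->]; split=> //=; lia.
rewrite (esumID [set n] (_ `&` ~` _))//.
rewrite (_ : _ `&` [set n] = [set n]); last first.
  by apply/seteqP; split => [k []//|k ->]; split=> //=; split => /=; lia.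
rewrite !esum_set1// addeA; congr (_ + _)%E.
case: n => [|n].
  rewrite (_ : _ `&` _ = set0) ?esum_set0//.
  by apply/seteqP; split => // k [[[/= a c] d] e]; lia.
rewrite (_ : _ `&` _ = [set n]) ?esum_set1//.
by apply/seteqP; split => [k [[[/= a c] d] e]|k /= ->]; [lia|do 3?split => /=; lia].
Qed.

Lemma esum_psum L n F : (forall g, 0 <= F g) ->
  \esum_(g in motzkin_from L n) (F g * sigma ^+ flats L g)%:E = (psum L n F)%:E.
Proof.
elim: L n F => [|L IH] n F F0.
  rewrite motzkin_from0 esum_set1/= /flats ?big_geq ?mulr1//.
  by rewrite lee_fin F0.
have s0 k : 0 <= sigma ^+ k by rewrite exprn_ge0// ltW.
rewrite motzkin_fromS esum_image; last by move=> g g' _ _ [].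
rewrite esum_bigcupT; last 2 first.
- by move=> i j _ _ [g [[_ <-] [_ <-]]].
- by move=> g; rewrite lee_fin mulr_ge0.
rewrite esum_neighbours => [|m]; last first.
  by apply: esum_ge0 => g _; rewrite lee_fin mulr_ge0.
have E m : \esum_(g in motzkin_from L m) (F (n :: g) * sigma ^+ flats L.+1 (n :: g))%:E
    = ((if m == n then sigma else 1) * psum L m (F \o cons n))%:E.
  rewrite -psumZ -IH => [|g]; last by rewrite mulr_ge0//=; case: ifP => // _; apply: ltW.
  apply: eq_esum => g [_ gm]; congr EFin.
  by rewrite flats_cons gm exprD /=; case: eqP => _; rewrite ?expr1 ?expr0; ring.
rewrite /= !E eqxx gtn_eqF// mul1r; case: n E => [|n] E; first by rewrite adde0 addr0.
by rewrite E ltn_eqF// mul1r.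
Qed.

Lemma path_weight_series (alpha beta : nat -> R) L (A : set (seq nat)) :
  (forall n, 0 <= alpha n) -> (forall n, 0 <= beta n) ->
  path_weight alpha beta sigma L A =
  (\sum_(0 <= n <oo) (alpha n * psum L n (fun g => \1_A g * beta (gam g L)))%:E)%E.
Proof.
move=> a0 b0; have s0 k : 0 <= sigma ^+ k by rewrite exprn_ge0// ltW.
rewrite /path_weight esum_mkcondr nneseries_esumT => [|n]; last first.
  by rewrite lee_fin mulr_ge0 ?psum_ge0// => g; rewrite mulr_ge0.
rewrite (_ : motzkin L = \bigcup_n motzkin_from L n); last first.
  by apply/seteqP; split => [g mg|g [n _ []//]]; exists (gam g 0).
rewrite esum_bigcupT; last 2 first.
- by move=> i j _ _ [g [[_ <-] [_ <-]]].
- by move=> g; case: ifP => // _; rewrite lee_fin !mulr_ge0.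
apply: eq_esum => n _; rewrite -psumZ -esum_psum => [|g]; last by rewrite !mulr_ge0.
apply: eq_esum => g [_ gn]; rewrite indicE /path_mass /gam.
case: ifP => _; last by rewrite mul0r mulr0 mul0r.
by congr EFin; move: gn => /= <-; rewrite /gam mul1r; ring.
Qed.

Lemma psumS L n F :
  psum L.+1 n F = transfer (fun m => psum L m (F \o cons n)) n.
Proof. by []. Qed.

Lemma transferZ a f n : transfer (fun m => a * f m) n = a * transfer f n.
Proof. exact: (titerZ 1). Qed.

Lemma eq_transfer f g n :
  (forall m, (n <= m.+1)%N -> f m = g m) -> transfer f n = transfer g n.
Proof.
move=> fg; rewrite /transfer !fg//; last exact: leqW.
by case: n fg => // n ->.
Qed.

Lemma psum_drop N K n F :
  psum (N + K) n (F \o drop N) = titer N (fun m => psum K m F) n.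
Proof.
elim: N n => [|N IH] n; last first.
  by rewrite addSn psumS titerS; apply: eq_transfer => m _; rewrite -IH.
by congr psum; apply/funext => g; rewrite /= drop0.
Qed.

Lemma psum_last L n f : psum L n (fun g => f (gam g L)) = titer L f n.
Proof.
have := psum_drop L 0 n (fun g => f (gam g 0)); rewrite addn0 /= => <-.
by congr psum; apply/funext => g; rewrite /gam /= -[in LHS](addn0 L) -nth_drop.
Qed.

Lemma psum_prefix K M n (z : nat -> nat) F :
  psum (K + M) n (fun g => \1_[set g | forall k, (k <= K)%N -> gam g k = z k] g
                          * F (drop K g))
  = (n == z 0)%:R * (\prod_(0 <= k < K) transfer (point (z k.+1)) (z k)
     * psum M (z K) F).
Proof.
elim: K n z => [|K IH] n z.
  rewrite big_geq// mul1r; case: eqP => [->|nz].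
    rewrite mul1r; apply: eq_psum => g _ gz.
    by rewrite indicE drop0 mem_set ?mul1r//= => k; rewrite leqn0 => /eqP ->.
  rewrite mul0r -[RHS](mul0r (psum M n F)) -psumZ add0n.
  apply: eq_psum => g _ gz; rewrite indicE memNset ?mul0r//= => /(_ 0%N isT) E.
  by apply: nz; rewrite -gz E.
rewrite addSn psumS.
transitivity (transfer (fun m => ((n == z 0)%:R
   * (\prod_(0 <= k < K) transfer (point (z k.+2)) (z k.+1) * psum M (z K.+1) F))
   * point (z 1) m) n).
  apply: eq_transfer => m _.
  transitivity ((n == z 0%N)%:R * psum (K + M) m
     (fun g => \1_[set g | forall k, (k <= K)%N -> gam g k = z k.+1] g * F (drop K g))).
    rewrite -psumZ; congr psum; apply/funext => g /=.
    rewrite mulrA; congr (_ * _).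
    rewrite !indicE; case: eqP => [nz|nz]; rewrite ?mul1r ?mul0r.
      congr ((nat_of_bool _)%:R); apply/idP/idP => /set_mem H; apply/mem_set => k kK.
        exact: (H k.+1).
      by case: k kK => //= k kK; exact: H.
    by rewrite memNset// => /(_ 0%N isT).
  by rewrite (IH m (fun k => z k.+1)) /point; ring.
rewrite transferZ big_nat_recl//; case: eqP => [->|_]; last by rewrite !mul0r.
by ring.
Qed.

Lemma Qker_transfer n m :
  Qker rho sigma n m = transfer (point m) n * h m / (S * h n).
Proof.
have hn := hfun_gt0 n; have hm := hfun_gt0 m.
have tE : transfer (point m) n =
    (if m == n.+1 then 1 else if m == n then sigma else if m.+1 == n then 1 else 0).
  rewrite /transfer /point; case: n {hn} => [|n].
    by case: m {hm} => [|[|m]] //=; ring.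
  case: (eqVneq m n.+2) => [->|m2].
    by rewrite ?eqxx !ltn_eqF//=; ring.
  case: (eqVneq m n.+1) => [->|m1].
    by rewrite (ltn_eqF (ltnSn n)) /=; ring.
  rewrite eqSS [n == m]eq_sym.
  by case: (m == n) => /=; ring.
rewrite tE {tE hm}; move: hn; rewrite /Qker /hfun; case: eqP => [r1|/eqP r1] hn.
  have n1 k : 1 + k%:R != 0 :> R by rewrite nat1r pnatr_eq0.
  have n2 k : 2 + k%:R != 0 :> R by rewrite -natrD pnatr_eq0.
  have s2 : 2 + sigma != 0 by rewrite gt_eqF// addr_gt0.
  rewrite r1 invr1; case: eqP => [->|_]; first by field; rewrite ?n1 ?n2 s2.
  case: eqP => [->|_]; first by field; rewrite ?n1 ?n2 s2.
  by case: eqP => [<-|_]; [field; rewrite ?n1 ?n2 s2 | rewrite !mul0r].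
have d0 : rho - rho^-1 != 0.
  by apply/eqP => E; move: hn; rewrite E invr0 mulr0 ltxx.
have p0 : rho ^+ n.+1 - rho ^- n.+1 != 0.
  by apply/eqP => E; move: hn; rewrite E mul0r ltxx.
have := S_gt0; move: (S) => s s0.
move: (rho - rho^-1) d0 => a a0.
case: eqP => [->|_].
  move: (rho ^+ n.+2 - _) (rho ^+ n.+1 - _) p0 => q p p0.
  by field; rewrite a0 p0 gt_eqF.
case: eqP => [->|_].
  by move: (rho ^+ n.+1 - _) p0 => p p0; field; rewrite a0 p0 gt_eqF.
case: eqP => [mn|_]; last by rewrite mulr0 !mul0r.
rewrite -mn in p0 *; move: (rho ^+ m.+2 - _) p0 (rho ^+ m.+1 - _) => p p0 q.
by field; rewrite a0 p0 gt_eqF.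
Qed.

Lemma prod_Qker K (z : nat -> nat) :
  \prod_(0 <= k < K) Qker rho sigma (z k) (z k.+1) =
  \prod_(0 <= k < K) transfer (point (z k.+1)) (z k)
    * h (z K) / (S ^+ K * h (z 0)).
Proof.
have h0 n : h n != 0 by rewrite gt_eqF ?hfun_gt0.
have := S_gt0; elim: K => [|K IH] S0; first by rewrite !big_geq// !mul1r divff.
rewrite !big_nat_recr//= IH// Qker_transfer exprSr.
move: (\prod_(_ <= _ < _) _) (S) S0 => P s s0; field.
by rewrite !h0 expf_neq0 gt_eqF.
Qed.

Lemma transfer_increment m (x : int) : (0 < m)%N ->
  transfer (fun m' => (m%:Z - m'%:Z == x)%:R * rho ^+ m') m
  = S * xi_law rho sigma x * rho ^+ m.
Proof.
case: m => // m _; rewrite /transfer /xi_law.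
have -> : (m.+1%:Z - m.+2%:Z == x) = (x == -1) by apply/eqP/eqP; lia.
have -> : (m.+1%:Z - m.+1%:Z == x) = (x == 0) by apply/eqP/eqP; lia.
have -> : (m.+1%:Z - m%:Z == x) = (x == 1) by apply/eqP/eqP; lia.
have := S_gt0; move: (S) => s s0; have sn : s != 0 by rewrite gt_eqF.
case: eqP => [->|_] /=; first by rewrite exprS; field; rewrite ?sn ?rn0.
case: eqP => [->|_] /=; first by field.
case: eqP => _ /=; last by ring.
by rewrite [rho ^+ m.+1]exprS; field; rewrite ?sn ?rn0.
Qed.

Lemma transfer_increment_le m (x : int) :
  transfer (fun m' => (m%:Z - m'%:Z == x)%:R * rho ^+ m') m
  <= S * xi_law rho sigma x * rho ^+ m.
Proof.
case: m => [|m]; last by rewrite transfer_increment.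
have := @transfer_increment 1 x isT; rewrite expr1.
rewrite -(ler_pM2r r0) expr0 mulr1 => <-; rewrite /transfer.
have -> : (0%:Z - 1%:Z == x) = (1%:Z - 2%:Z == x) by apply/eqP/eqP; lia.
have -> : (0%:Z - 0%:Z == x) = (1%:Z - 1%:Z == x) by apply/eqP/eqP; lia.
rewrite -[leLHS]addr0 lerD ?mulr_ge0//.
by rewrite le_eqVlt; apply/orP; left; apply/eqP; ring.
Qed.

(** * The last increments *)

Definition end_weight (K : nat) (x : nat -> int) (m : nat) : R :=
  psum K m (fun g => \1_[set g | forall k, (1 <= k <= K)%N -> incr K g k = x k] g
    * rho ^+ gam g K).

Lemma end_weight_ge0 K x m : 0 <= end_weight K x m.
Proof. by apply: psum_ge0 => g; rewrite mulr_ge0// exprn_ge0// ltW. Qed.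

Lemma end_weightS K x m : end_weight K.+1 x m =
  transfer (fun m' => (m%:Z - m'%:Z == x K.+1)%:R * end_weight K x m') m.
Proof.
rewrite /end_weight psumS; apply: eq_transfer => m' _; rewrite -psumZ.
apply: eq_psum => g sg gm' /=; rewrite mulrA; congr (_ * _).
have iS k : (1 <= k <= K)%N -> incr K.+1 (m :: g) k = incr K g k.
  by move=> /andP[k0 kK]; rewrite /incr (leqW kK) kK subSn.
have iK : incr K.+1 (m :: g) K.+1 = (m%:Z - m'%:Z)%R.
  by rewrite /incr leqnn subnn /gam /= -gm'.
rewrite !indicE -natrM mulnb; congr ((nat_of_bool _)%:R).
apply/idP/andP => [/set_mem H|[/eqP E /set_mem H]].
  split; first by rewrite -iK H ?leqnn//.
  by apply/mem_set => k /andP[k0 kK]; rewrite -iS ?k0//= H ?k0//= leqW.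
apply/mem_set => k /andP[k0]; rewrite leq_eqVlt => /predU1P[->|kK]; first by rewrite iK.
by rewrite iS ?H ?k0.
Qed.

Lemma end_weight_le K x m :
  end_weight K x m <= S ^+ K * \prod_(1 <= k < K.+1) xi_law rho sigma (x k) * rho ^+ m.
Proof.
elim: K m => [|K IH] m.
  rewrite big_geq// !mul1r /end_weight /=.
  by rewrite ler_piMl// ?exprn_ge0 ?ltW// indicE; case: (_ \in _).
rewrite end_weightS; set c := S ^+ K * _ in IH.
apply: (@le_trans _ _ (transfer
   (fun m' => c * ((m%:Z - m'%:Z == x K.+1)%:R * rho ^+ m')) m)).
  by apply: transfer_le => m'; rewrite mulrCA ler_wpM2l.
rewrite transferZ big_nat_recr//= exprSr.
rewrite [leRHS](_ : _ = c * (S * xi_law rho sigma (x K.+1) * rho ^+ m)); last first.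
  by rewrite /c; ring.
rewrite ler_wpM2l ?transfer_increment_le//.
by have := le_trans (end_weight_ge0 K x 0) (IH 0%N); rewrite mulr1.
Qed.

Lemma end_weight_eq K x m : (K <= m)%N ->
  end_weight K x m = S ^+ K * \prod_(1 <= k < K.+1) xi_law rho sigma (x k) * rho ^+ m.
Proof.
elim: K m => [|K IH] m Km.
  rewrite big_geq// !mul1r /end_weight /= indicE mem_set ?mul1r//=.
  by move=> k /andP[]; case: k.
rewrite end_weightS; set c := S ^+ K * _ in IH.
transitivity (transfer (fun m' => c * ((m%:Z - m'%:Z == x K.+1)%:R * rho ^+ m')) m).
  apply: eq_transfer => m' mm'; rewrite mulrCA -IH//.
  by rewrite -ltnS (leq_trans Km).
rewrite transferZ transfer_increment ?(leq_ltn_trans _ Km)//.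
by rewrite big_nat_recr//= exprSr /c; ring.
Qed.

Lemma titer_end_weight_cvg K x n :
  titer L (end_weight K x) n / W L 0 @[L --> \oo] -->
  S ^+ K * \prod_(1 <= k < K.+1) xi_law rho sigma (x k) * h n.
Proof.
set c := S ^+ K * _.
pose e L := \sum_(i < K) (c * rho ^+ i) * (titer L (point i) n / W L 0).
apply: (@squeeze_cvgr _ _ _ _ (fun L => c * (W L n / W L 0) - e L)
   (fun L => c * (W L n / W L 0))).
- near=> L; have W0 := W_gt0 L 0.
  rewrite /e mulrA; under eq_bigr do rewrite mulrA.
  rewrite -mulr_suml -mulrBl !ler_pM2r ?invr_gt0//; apply/andP; split; last first.
    by rewrite -titerZ; apply: titer_le => m; exact: end_weight_le.
  under eq_bigr do rewrite -titerZ.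
  rewrite -(titer_sum L (fun i k => c * rho ^+ i * point i k)) -titerZ.
  have := titer_lin L 1 (-1) (fun m => c * rho ^+ m)
    (fun k => \sum_(i < K) c * rho ^+ i * point i k) n.
  rewrite mul1r mulN1r => <-; apply: titer_le => m; rewrite mul1r mulN1r.
  have [Km|mK] := leqP K m.
    rewrite end_weight_eq// -/c lerBlDr lerDl sumr_ge0// => i _.
    by rewrite /point gtn_eqF ?mulr0// (leq_trans (ltn_ord i)).
  rewrite (bigD1 (Ordinal mK))//= big1 => [|i im].
    by rewrite /point eqxx mulr1 addr0 subrr end_weight_ge0.
  rewrite /point eq_sym; case: eqP => [E|]; last by rewrite mulr0.
  by move: im; rewrite -val_eqE /= E eqxx.
- rewrite -[X in _ --> X]subr0; apply: cvgB.
    by apply: cvgM; [exact: cvg_cst | exact: W_ratio_hfun].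
  rewrite -[X in _ --> X](_ : \sum_(i < K) (c * rho ^+ i) * 0 = 0); last first.
    by rewrite big1// => i _; rewrite mulr0.
  apply: cvg_big => [|i _]; first exact: add_continuous.
  by apply: cvgM; [exact: cvg_cst | exact: titer_point_cvg0].
- by apply: cvgM; [exact: cvg_cst | exact: W_ratio_hfun].
Unshelve. all: by end_near.
Qed.

(** * Sums over the starting point *)

Variable alpha : nat -> R.
Hypotheses (alpha_ge0 : forall n, 0 <= alpha n)
  (alpha_nz : exists n, alpha n != 0)
  (alpha_moment : (\sum_(0 <= m <oo) (m%:R * alpha m * rho ^+ m)%:E < +oo)%E).

Lemma alpha_hfun_ge0 n : 0 <= alpha n * h n.
Proof. by rewrite mulr_ge0// ltW// hfun_gt0. Qed.

Lemma Calpha_series :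
  (\sum_(0 <= n <oo) (alpha n * h n)%:E = (Calpha alpha rho)%:E)%E.
Proof.
rewrite /Calpha fineK// ge0_fin_numE; last first.
  by apply: nneseries_ge0 => n _ _; rewrite lee_fin alpha_hfun_ge0.
have t0 n : (0 <= (n%:R * alpha n * rho ^+ n)%:E)%E.
  by rewrite lee_fin !mulr_ge0// exprn_ge0// ltW.
have d0 n : (0 <= (alpha 0 * point 0 n)%:E)%E.
  by rewrite lee_fin mulr_ge0// point_ge0.
apply: (@le_lt_trans _ _ (\sum_(0 <= n <oo) ((alpha 0 * point 0 n)%:E
    + 2%:E * (n%:R * alpha n * rho ^+ n)%:E))%E).
  apply: lee_nneseries => n _; first by rewrite lee_fin alpha_hfun_ge0.
  rewrite -EFinM -EFinD lee_fin /point.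
  have := ler_wpM2l (alpha_ge0 n) (hfun_le n); move=> /le_trans; apply.
  case: n => [|n]; first by rewrite /= expr0; lra.
  rewrite /= mulr0 add0r [leRHS](_ : _ = alpha n.+1 * ((2 * n.+1%:R) * rho ^+ n.+1));
    last by ring.
  rewrite ler_wpM2l// ler_wpM2r ?exprn_ge0 ?(ltW r0)// -natrM ler_nat; lia.
rewrite nneseriesD => [|n _ _|n _ _]; [|exact: d0|by rewrite mule_ge0].
rewrite nneseriesZl//; rewrite (nneseries_delta (k := 0%N)) => [||n /negbTE n0]; last 2 first.
- by rewrite mulr_ge0// point_ge0.
- by rewrite /point n0 mulr0.
by rewrite lte_add_pinfty ?ltry// lte_mul_pinfty// lee_fin.
Qed.

Lemma Calpha_gt0 : 0 < Calpha alpha rho.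
Proof.
have [n an] := alpha_nz.
rewrite -lte_fin -Calpha_series (nneseriesD1 (n := n))//; last first.
  by move=> k _; rewrite lee_fin alpha_hfun_ge0.
apply: (@lt_le_trans _ _ (alpha n * h n)%:E).
  by rewrite lte_fin mulr_gt0 ?hfun_gt0// lt0r an alpha_ge0.
by rewrite leeDl//; apply: nneseries_ge0 => k _ _; rewrite lee_fin alpha_hfun_ge0.
Qed.

Lemma partition_series L :
  partition_fn alpha b sigma L = (\sum_(0 <= n <oo) (alpha n * W L n)%:E)%E.
Proof.
rewrite /partition_fn path_weight_series// => [|n]; last by rewrite exprn_ge0// ltW.
apply: eq_eseriesr => n _; congr (_ * _)%:E.
rewrite /W -psum_last; congr psum; apply/funext => g.
by rewrite indicT mul1r.
Qed.

Lemma fine_partition L : fine (partition_fn alpha b sigma L) =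
  W L 0 * fine (\sum_(0 <= n <oo) (alpha n * (W L n / W L 0))%:E)%E.
Proof.
rewrite partition_series -fine_nneseriesZl ?W_gt0// => [|n].
  congr fine; apply: eq_eseriesr => n _; congr EFin.
  by field; rewrite gt_eqF ?W_gt0.
by rewrite mulr_ge0// divr_ge0// ltW// W_gt0.
Qed.

Lemma W_ratio_bounds L n : 0 <= W L n / W L 0 <= h n.
Proof.
by rewrite divr_ge0 ?(ltW (W_gt0 _ _))//= ler_pdivrMr ?W_gt0// W_le.
Qed.

Lemma partition_ratio :
  fine (partition_fn alpha b sigma L) / W L 0 @[L --> \oo] --> Calpha alpha rho.
Proof.
have -> : (fun L => fine (partition_fn alpha b sigma L) / W L 0) =
    (fun L => fine (\sum_(0 <= n <oo) (alpha n * (W L n / W L 0))%:E)%E).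
  by apply/funext => L; rewrite fine_partition mulrC mulKf// gt_eqF ?W_gt0.
apply: (cvg_dominated_nneseries Calpha_series) => [L n|n].
  by have /andP[lo hi] := W_ratio_bounds L n; rewrite mulr_ge0//= ler_wpM2l.
by apply: cvgM; [exact: cvg_cst|exact: W_ratio_hfun].
Qed.

Lemma titer_bounded_end_cvg0 M n :
  titer L (fun m => (m <= M)%N%:R * rho ^+ m) n / W L 0 @[L --> \oo] --> (0 : R).
Proof.
have E L : titer L (fun m => (m <= M)%N%:R * rho ^+ m) n / W L 0 =
    \sum_(i < M.+1) rho ^+ i * (titer L (point i) n / W L 0).
  under eq_bigr do rewrite mulrA -titerZ.
  rewrite -mulr_suml -(titer_sum L (fun i k => rho ^+ i * point i k)).
  congr (titer L _ n / _); apply/funext => m; rewrite /point.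
  have [mM|Mm] := leqP m M.
    rewrite (bigD1 (Ordinal (mM : (m < M.+1)%N)))//= eqxx big1 => [|i im].
      by rewrite mul1r mulr1 addr0.
    case: eqP => [E|]; last by rewrite mulr0.
    by move: im; rewrite -val_eqE /= E eqxx.
  rewrite mul0r big1// => i _; rewrite gtn_eqF ?mulr0//.
  by rewrite (leq_ltn_trans _ Mm)// -ltnS.
rewrite (funext E).
rewrite -[X in _ --> X](_ : \sum_(i < M.+1) rho ^+ i * 0 = 0); last first.
  by rewrite big1// => i _; rewrite mulr0.
apply: cvg_big => [|i _]; first exact: add_continuous.
by apply: cvgM; [exact: cvg_cst | exact: titer_point_cvg0].
Qed.

Lemma PrL_bounded_end_cvg0 M :
  PrL alpha b sigma L [set g | (gam g L <= M)%N] @[L --> \oo] --> (0 : R).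
Proof.
pose f m : R := (m <= M)%N%:R * rho ^+ m.
have f0 m : 0 <= f m by rewrite mulr_ge0// exprn_ge0// ltW.
have fb m : f m <= b m.
  by rewrite /f ler_piMl ?exprn_ge0 ?(ltW r0)//; case: (m <= M)%N.
pose u L n := alpha n * (titer L f n / W L 0).
have u_ge0 L n : 0 <= u L n.
  by rewrite mulr_ge0// divr_ge0 ?(titer_ge0 _ f0) ?(ltW (W_gt0 _ _)).
have u_le L n : u L n <= alpha n * h n.
  rewrite ler_wpM2l//; have /andP[_] := W_ratio_bounds L n; apply: le_trans.
  by rewrite ler_wpM2r ?invr_ge0 ?(ltW (W_gt0 _ _)) ?(titer_le _ fb).
have pwE L : fine (path_weight alpha b sigma L [set g | (gam g L <= M)%N]) =
    W L 0 * fine (\sum_(0 <= n <oo) (u L n)%:E)%E.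
  rewrite path_weight_series// => [|n]; last by rewrite exprn_ge0// ltW.
  rewrite -fine_nneseriesZl ?W_gt0//.
  congr fine; apply: eq_eseriesr => n _; congr EFin.
  rewrite [RHS](_ : _ = alpha n * titer L f n); last first.
    by rewrite /u; field; rewrite gt_eqF ?W_gt0.
  rewrite -psum_last; congr (_ * psum _ _ _); apply/funext => g.
  rewrite /f indicE; congr (_%:R * _); congr nat_of_bool.
  by apply/idP/idP => [/set_mem//|H]; apply/mem_set.
have ufin L : fine (\sum_(0 <= n <oo) (u L n)%:E)%E =
    Calpha alpha rho - fine (\sum_(0 <= n <oo) (alpha n * h n - u L n)%:E)%E.
  have v0 n : (0 <= (alpha n * h n - u L n)%:E)%E by rewrite lee_fin subr_ge0.
  have u0 n : (0 <= (u L n)%:E)%E by rewrite lee_fin.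
  have sumE : (\sum_(0 <= n <oo) (u L n)%:E +
      \sum_(0 <= n <oo) (alpha n * h n - u L n)%:E = (Calpha alpha rho)%:E)%E.
    rewrite -nneseriesD// -Calpha_series; apply: eq_eseriesr => n _.
    by rewrite -EFinD addrC subrK.
  have us : (0 <= \sum_(0 <= n <oo) (u L n)%:E)%E by exact: nneseries_ge0.
  have vs : (0 <= \sum_(0 <= n <oo) (alpha n * h n - u L n)%:E)%E by exact: nneseries_ge0.
  move: sumE us vs; move: (\sum_(0 <= n <oo) (u L n)%:E)%E => s.
  move: (\sum_(0 <= n <oo) (alpha n * h n - u L n)%:E)%E => t.
  case: s => [s| |]; case: t => [t| |] //=.
  by move=> [<-]; rewrite addrK.
have ucvg0 : fine (\sum_(0 <= n <oo) (u L n)%:E)%E @[L --> \oo] --> (0 : R).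
  rewrite (funext ufin).
  rewrite -[X in _ --> X](subrr (Calpha alpha rho)).
  apply: cvgB; first exact: cvg_cst.
  apply: (cvg_dominated_nneseries Calpha_series) => [L n|n].
    by rewrite subr_ge0 u_le gerBl u_ge0.
  rewrite -[X in _ --> X]subr0; apply: cvgB; first exact: cvg_cst.
  rewrite -[X in _ --> X](mulr0 (alpha n)).
  by apply: cvgM; [exact: cvg_cst | exact: titer_bounded_end_cvg0].
have -> : (fun L => PrL alpha b sigma L [set g | (gam g L <= M)%N]) =
    (fun L => fine (\sum_(0 <= n <oo) (u L n)%:E)%E
      / (fine (partition_fn alpha b sigma L) / W L 0)).
  by apply/funext => L; rewrite /PrL pwE invfM invrK; ring.
rewrite -[X in _ --> X](mul0r (Calpha alpha rho)^-1).
apply: cvgM => //; apply: cvgV; last exact: partition_ratio.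
by rewrite gt_eqF ?Calpha_gt0.
Qed.

Lemma path_weight_cyl N K z x :
  fine (path_weight alpha b sigma (K + (N + K)) (cyl (K + (N + K)) K z x)) =
  alpha (z 0) * (\prod_(0 <= k < K) transfer (point (z k.+1)) (z k)
    * titer N (end_weight K x) (z K)).
Proof.
set L := (K + (N + K))%N.
pose F g := \1_[set g | forall k, (1 <= k <= K)%N -> incr K g k = x k] g
    * rho ^+ gam g K.
have E n : psum L n (fun g => \1_(cyl L K z x) g * rho ^+ gam g L) =
    (n == z 0)%:R * (\prod_(0 <= k < K) transfer (point (z k.+1)) (z k)
      * titer N (end_weight K x) (z K)).
  have := psum_prefix K (N + K) n z (F \o drop N); rewrite psum_drop => <-.
  congr psum; apply/funext => g; rewrite /F /= mulrA; congr (_ * _ ^+ _); last first.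
    by rewrite /gam !nth_drop.
  have iE k : (1 <= k <= K)%N -> incr L g k = incr K (drop N (drop K g)) k.
    move=> /andP[_ kK]; have kL : (k <= L)%N by rewrite /L; lia.
    rewrite /incr kL kK /gam !nth_drop; congr (Posz (nth _ _ _) - Posz (nth _ _ _));
      rewrite /L; lia.
  rewrite !indicE -natrM mulnb; congr ((nat_of_bool _)%:R).
  apply/idP/andP => [/set_mem[H1 H2]|[/set_mem H1 /set_mem H2]].
    by split; apply/mem_set => // k kK; rewrite -iE// H2.
  by apply/mem_set; split=> // k kK; rewrite iE// H2.
have ge0 n : 0 <= alpha n * psum L n (fun g => \1_(cyl L K z x) g * rho ^+ gam g L).
  by rewrite mulr_ge0// psum_ge0// => g; rewrite mulr_ge0// exprn_ge0// ltW.
rewrite path_weight_series// => [|n]; last by rewrite exprn_ge0// ltW.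
rewrite (nneseries_delta (k := z 0%N))//=; first by rewrite E eqxx mul1r.
by move=> n /negbTE nz; rewrite E nz mul0r mulr0.
Qed.

Lemma PrL_cyl_cvg K z x :
  PrL alpha b sigma L (cyl L K z x) @[L --> \oo] --> limit_fdd alpha rho sigma K z x.
Proof.
have S0 := S_gt0; have C0 := Calpha_gt0.
rewrite -(cvg_shiftn (K + K)) /=.
set P := \prod_(0 <= k < K) transfer (point (z k.+1)) (z k).
have -> : (fun N => PrL alpha b sigma (N + (K + K)) (cyl (N + (K + K)) K z x)) =
  (fun N => alpha (z 0) * (P * (titer N (end_weight K x) (z K) / W N 0))
     / (fine (partition_fn alpha b sigma (N + (K + K))) / W (N + (K + K)) 0
        * (W (N + (K + K)) 0 / W N 0))).
  apply/funext => N; rewrite (_ : (N + (K + K) = K + (N + K))%N); last lia.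
  rewrite /PrL path_weight_cyl -/P.
  set p := fine (partition_fn _ _ _ _).
  rewrite [p / _ * _]mulrA mulfVK ?gt_eqF ?W_gt0// invfM invrK.
  move: (p^-1) (W N 0) (W_gt0 N 0) => q w w0.
  by field; rewrite gt_eqF.
have -> : limit_fdd alpha rho sigma K z x =
    alpha (z 0) * (P * (S ^+ K * \prod_(1 <= k < K.+1) xi_law rho sigma (x k) * h (z K)))
      / (Calpha alpha rho * (S ^+ (K + K) * h 0)).
  rewrite /limit_fdd /init_law prod_Qker -/P hfun0 exprD.
  have := hfun_gt0 (z 0); move: (\prod_(_ <= _ < _) xi_law _ _ _) (S) S0 => X s s0 hz.
  field; rewrite !gt_eqF ?exprn_gt0//.
apply: cvgM.
  apply: cvgM; first exact: cvg_cst.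
  by apply: cvgM; [exact: cvg_cst | exact: titer_end_weight_cvg].
apply: cvgV; first by rewrite gt_eqF// !mulr_gt0 ?exprn_gt0 ?hfun_gt0.
apply: cvgM; last exact: W_shift_ratio.
by rewrite (cvg_shiftn (K + K) (fun L => fine (partition_fn alpha b sigma L) / W L 0));
  exact: partition_ratio.
Qed.

End Transfer.

Unset Implicit Arguments.

Theorem theorem1p2 (R : realType) (sigma rho1 : R) (alpha : nat -> R)
  (hsigma : 0 < sigma) (hrho : 1 <= rho1)
  (halpha_nonneg : forall n, 0 <= alpha n)
  (halpha_nz : exists n, alpha n != 0)
  (hsum : (\sum_(0 <= m <oo) (m%:R * alpha m * rho1 ^+ m)%:E < +oo)%E) :
  let beta := fun n : nat => rho1 ^+ n in
  (* {gamma^{(L)}_L}_{L >= 1} is not tight *)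
  ~ (forall eps : R, 0 < eps -> exists M : nat, forall L : nat, (1 <= L)%N ->
        1 - eps <= PrL alpha beta sigma L [set g | (gam g L <= M)%N])
  /\
  (* convergence of finite-dimensional distributions *)
  (forall (K : nat) (z : nat -> nat) (x : nat -> int),
     PrL alpha beta sigma L (cyl L K z x) @[L --> \oo] -->
       limit_fdd alpha rho1 sigma K z x).
Proof.
move=> beta; split; last by move=> K z x; exact: PrL_cyl_cvg.
move=> /(_ (1 / 2)); rewrite divr_gt0// => /(_ isT)[M tight].
have := PrL_bounded_end_cvg0 hsigma hrho halpha_nonneg halpha_nz hsum M.
move=> /cvgrPdist_lt/(_ (1 / 2)); rewrite divr_gt0// => /(_ isT)[N _ small].
have := tight N.+1 isT; have := small N.+1 (leqnSn N).
by rewrite /= sub0r normrN => /ltr_normlW; lra.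
Qed.
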